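(* Let $H$ be a Hopf algebra with bijective antipode over a field $k$. Let $k$ be a right $H$-module via a character $\delta:H\to k$ and a left $H$-comodule via a group-like element $\sigma\in H$. Then $k={}^\sigma k_\delta$ is a stable anti-Yetter-Drinfeld module if and only if $(\delta,\sigma)$ is a modular pair in involution.
   Context: $H$ has coproduct $\Delta(h)=h^{(1)}\otimes h^{(2)}$, counit $\varepsilon$, antipode $S$; left coactions are written ${}_M\Delta(m)=m^{(-1)}\otimes m^{(0)}$ (summation suppressed). A character is a unital algebra homomorphism $H\to k$; a group-like $\sigma$ satisfies $\Delta(\sigma)=\sigma\otimes\sigma$, $\varepsilon(\sigma)=1$. The structures on ${}^\sigma k_\delta=k$ are $\lambda\cdot h=\lambda\delta(h)$ and $\lambda\mapsto\sigma\otimes\lambda$. A right $H$-module and left $H$-comodule $M$ is anti-Yetter-Drinfeld if ${}_M\Delta(mh)=S(h^{(3)})m^{(-1)}h^{(1)}\otimes m^{(0)}h^{(2)}$ for all $m\in M$, $h\in H$, and stable if $m^{(0)}m^{(-1)}=m$ for all $m\in M$. $(\delta,\sigma)$ is a modular pair in involution (Connes–Moscovici) if $\delta(\sigma)=1$ and the twisted antipode $\widetilde S(h):=\delta(h^{(1)})S(h^{(2)})$ satisfies $\widetilde S^2(h)=\sigma h\sigma^{-1}$ for all $h\in H$. *)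

(* Defs.v *)
From HB Require Import structures.
From mathcomp Require Import all_boot all_algebra finmap.
From mathcomp Require Import boolp monalg.

Set Implicit Arguments.
Unset Strict Implicit.
Unset Printing Implicit Defensive.

Import GRing.Theory.

Local Open Scope ring_scope.
Local Open Scope quotient_scope.

Reserved Notation "u ⊗ v" (at level 45, left associativity).
Reserved Notation "'\tsum_' ( a ⊗ b <- t ) E"
  (at level 50, a name, b name, t at level 200, E at level 50,
   format "'[' '\tsum_' ( a  ⊗  b  <-  t ) '/  '  E ']'").

Definition bilinear_map (k : fieldType) (U V W : lmodType k) (f : U -> V -> W) :=
  (forall v, linear (f^~ v)) /\ (forall u, linear (f u)).

(* The tensor product over k is the free module on U * V modulo the subspace  *)
(* spanned by the bilinearity relations.                                      *)
Section Tensor.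
Context {k : fieldType}.

Inductive tensor_ker (U V : lmodType k) : {malg k[(U * V)%type]} -> Prop :=
| tensor_ker0 : tensor_ker 0
| tensor_kerP a x y : tensor_ker x -> tensor_ker y -> tensor_ker (a *: x + y)
| tensor_kerl a u u' v :
    tensor_ker (<< (a *: u + u', v) >> - a *: << (u, v) >> - << (u', v) >>)
| tensor_kerr a u v v' :
    tensor_ker (<< (u, a *: v + v') >> - a *: << (u, v) >> - << (u, v') >>).

Section Quotient.
Context (U V : lmodType k).
Local Notation F := {malg k[(U * V)%type]}.

Lemma tensor_kerZ a (x : F) : tensor_ker x -> tensor_ker (a *: x).
Proof. by move=> xP; rewrite -[_ *: _]addr0; apply: tensor_kerP => //; exact: tensor_ker0. Qed.

Lemma tensor_kerD (x y : F) : tensor_ker x -> tensor_ker y -> tensor_ker (x + y).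
Proof. by move=> xP yP; rewrite -[x]scale1r; apply: tensor_kerP. Qed.

Lemma tensor_kerN (x : F) : tensor_ker x -> tensor_ker (- x).
Proof. by rewrite -scaleN1r; apply: tensor_kerZ. Qed.

Definition tensor_eq (x y : F) : bool := `[< tensor_ker (x - y) >].

Lemma tensor_eq_refl : reflexive tensor_eq.
Proof. by move=> x; apply/asboolP; rewrite subrr; exact: tensor_ker0. Qed.

Lemma tensor_eq_sym : symmetric tensor_eq.
Proof.
by move=> x y; apply/asboolP/asboolP => /tensor_kerN; rewrite opprB.
Qed.

Lemma tensor_eq_trans : transitive tensor_eq.
Proof.
move=> y x z /asboolP xy /asboolP yz; apply/asboolP.
rewrite (_ : x - z = (x - y) + (y - z)); first exact: tensor_kerD.
by rewrite addrA subrK.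
Qed.

Canonical tensor_equiv :=
  EquivRel tensor_eq tensor_eq_refl tensor_eq_sym tensor_eq_trans.

Definition tensor := {eq_quot tensor_equiv}.
HB.instance Definition _ := Choice.on tensor.
HB.instance Definition _ := EqQuotient.on tensor.

Lemma tensorP (x y : F) : reflect (tensor_ker (x - y)) (x == y %[mod tensor]).
Proof. by rewrite piE; apply: asboolP. Qed.

Definition tensor0 : tensor := \pi_tensor 0.
Definition tensorN (x : tensor) := \pi_tensor (- repr x).
Definition tensorD (x y : tensor) := \pi_tensor (repr x + repr y).
Definition tensorZ a (x : tensor) := \pi_tensor (a *: repr x).

Lemma ker_repr (x : F) : tensor_ker (x - repr (\pi_tensor x)).
Proof. by apply/tensorP; rewrite reprK. Qed.

Lemma piN (x : F) : tensorN (\pi_tensor x) = \pi_tensor (- x).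
Proof.
apply/esym/eqP/tensorP; rewrite -opprD; exact/tensor_kerN/ker_repr.
Qed.

Lemma piD (x y : F) : tensorD (\pi_tensor x) (\pi_tensor y) = \pi_tensor (x + y).
Proof.
apply/esym/eqP/tensorP; rewrite opprD addrACA.
by apply: tensor_kerD; apply: ker_repr.
Qed.

Lemma piZ a (x : F) : tensorZ a (\pi_tensor x) = \pi_tensor (a *: x).
Proof.
apply/esym/eqP/tensorP; rewrite -scalerBr; exact/tensor_kerZ/ker_repr.
Qed.

Lemma tensorDA : associative tensorD.
Proof.
move=> x y z; elim/quotW: x => x; elim/quotW: y => y; elim/quotW: z => z.
by rewrite (piD y z) (piD x y) !piD addrA.
Qed.

Lemma tensorDC : commutative tensorD.
Proof. by move=> x y; elim/quotW: x => x; elim/quotW: y => y; rewrite (piD x y) (piD y x) addrC. Qed.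

Lemma tensor0D : left_id tensor0 tensorD.
Proof. by move=> x; elim/quotW: x => x; rewrite piD add0r. Qed.

Lemma tensorND : left_inverse tensor0 tensorN tensorD.
Proof. by move=> x; elim/quotW: x => x; rewrite (piN x) piD addNr. Qed.

HB.instance Definition _ :=
  GRing.isZmodule.Build tensor tensorDA tensorDC tensor0D tensorND.

Lemma tensorZA a b v : tensorZ a (tensorZ b v) = tensorZ (a * b) v.
Proof. by elim/quotW: v => x; rewrite (piZ b x) !piZ scalerA. Qed.

Lemma tensor1Z : left_id 1 tensorZ.
Proof. by move=> x; elim/quotW: x => x; rewrite piZ scale1r. Qed.

Lemma tensorZDr : right_distributive tensorZ +%R.
Proof.
move=> a x y; elim/quotW: x => x; elim/quotW: y => y.
by rewrite /+%R /= (piD x y) (piZ a x) (piZ a y) piZ piD scalerDr.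
Qed.

Lemma tensorZDl v : {morph tensorZ^~ v : a b / a + b}.
Proof.
elim/quotW: v => x a b.
by rewrite [RHS]/+%R /= (piZ a x) (piZ b x) piZ piD scalerDl.
Qed.

HB.instance Definition _ := GRing.Zmodule_isLmodule.Build k tensor
  tensorZA tensor1Z tensorZDr tensorZDl.

Lemma pi_linear a (x y : F) :
  a *: (\pi x : tensor) + (\pi y : tensor) = \pi_tensor (a *: x + y).
Proof. exact: etrans (congr1 (tensorD^~ _) (piZ a x)) (piD _ _). Qed.

Definition free_lift (W : lmodType k) (f : U -> V -> W) (x : F) : W :=
  \sum_(p <- msupp x) x@_p *: f p.1 p.2.

End Quotient.
End Tensor.

Arguments tensor {k} (U V)%_type.

HB.lock Definition tens (k : fieldType) (U V : lmodType k) (u : U) (v : V) :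
  tensor U V := \pi_(tensor U V) << (u, v) >>.
Arguments tens {k U V} u v.

(* The linear map U ⊗ V -> W induced by f.  It is defined for every function  *)
(* f, but meaningful only for bilinear f: then tliftE and tlift_linear below  *)
(* characterize it.                                                           *)
HB.lock Definition tlift (k : fieldType) (U V W : lmodType k) (f : U -> V -> W)
  (t : tensor U V) : W := free_lift f (repr t).
Arguments tlift {k U V W} f t.

Notation "U ⊗ V" := (tensor U V) : type_scope.
Notation "u ⊗ v" := (tens u v) : ring_scope.
Notation "\tsum_ ( a ⊗ b <- t ) E" := (tlift (fun a b => E) t) : ring_scope.

Section TensorTheory.
Context {k : fieldType} {U V : lmodType k}.

Lemma tens_bilinear : bilinear_map (@tens k U V).
Proof.
split=> [v a u u'|u a v v']; rewrite tens.unlock [RHS]pi_linear;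
  apply/eqP/tensorP; rewrite opprD addrA.
  exact: tensor_kerl.
exact: tensor_kerr.
Qed.

Section Lift.
Context {W : lmodType k} (f : U -> V -> W).

Lemma free_liftEw (d : {fset (U * V)%type}) (x : {malg k[(U * V)%type]}) :
  (msupp x `<=` d)%fset -> free_lift f x = \sum_(p <- d) x@_p *: f p.1 p.2.
Proof.
move=> xd; rewrite /free_lift; apply: (big_fset_incl _ xd) => p _ xp.
by rewrite mcoeff_outdom // scale0r.
Qed.

Lemma free_lift_linear : linear (free_lift f).
Proof.
move=> a x y.
pose d := (msupp (a *: x + y) `|` (msupp x `|` msupp y))%fset.
rewrite (@free_liftEw d) ?fsubsetUl // (@free_liftEw d x); last first.
  by rewrite fsubsetU // fsubsetUl orbT.
rewrite (@free_liftEw d y); last by rewrite fsubsetU // fsubsetUr orbT.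
rewrite scaler_sumr -big_split /=; apply: eq_bigr => p _.
by rewrite mcoeffD mcoeffZ scalerDl scalerA.
Qed.

HB.instance Definition _ := GRing.isLinear.Build k {malg k[(U * V)%type]} W _
  (free_lift f) free_lift_linear.

Lemma free_liftU u v : free_lift f << (u, v) >> = f u v.
Proof.
by rewrite /free_lift msuppU oner_eq0 big_seq_fset1 mcoeffUU scale1r.
Qed.

Context (f_bilinear : bilinear_map f).

Lemma free_lift_ker (x : {malg k[(U * V)%type]}) :
  tensor_ker x -> free_lift f x = 0.
Proof.
case: f_bilinear => fl fr.
elim=> [|a y z _ y0 _ z0|a u u' v|a u v v']; first exact: linear0.
- by rewrite free_lift_linear y0 z0 scaler0 addr0.
- rewrite !linearB linearZ_LR /= !free_liftU (fl v a u u') /=.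
  by rewrite -addrA -opprD subrr.
- rewrite !linearB linearZ_LR /= !free_liftU (fr u a v v').
  by rewrite -addrA -opprD subrr.
Qed.

Lemma tlift_pi (x : {malg k[(U * V)%type]}) :
  tlift f (\pi_(U ⊗ V)%type x) = free_lift f x.
Proof.
apply/esym/eqP; rewrite tlift.unlock -subr_eq0 -linearB /=; apply/eqP.
exact/free_lift_ker/ker_repr.
Qed.

Lemma tliftE u v : tlift f (u ⊗ v) = f u v.
Proof. by rewrite tens.unlock tlift_pi free_liftU. Qed.

Lemma tlift_linear : linear (tlift f).
Proof.
move=> a x y; elim/quotW: x => x; elim/quotW: y => y.
by rewrite pi_linear !tlift_pi linearP.
Qed.

Lemma tlift0 : tlift f 0 = 0.
Proof.
by rewrite -[0 in LHS](subrr 0) -scaleN1r addrC tlift_linear scaleN1r addNr.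
Qed.

End Lift.

Lemma tensor_ind (P : (U ⊗ V)%type -> Prop) :
    P 0 -> (forall a u v t, P t -> P (a *: (u ⊗ v) + t)) -> forall t, P t.
Proof.
move=> P0 PD t; elim/quotW: t => x; rewrite [x]monalgE.
elim/big_rec: _ => [//|[u v] y _ Py].
have -> : << x@_(u, v) *g (u, v) >> = x@_(u, v) *: << (u, v) >> :> {malg k[_]}.
  by apply/malgP => p; rewrite mcoeffZ !mcoeffU mulrnAr mulr1.
rewrite -pi_linear; move: PD; rewrite tens.unlock; apply.
exact: Py.
Qed.

End TensorTheory.

Section TensorMaps.
Context {k : fieldType}.

Definition tmap (U V U' V' : lmodType k) (f : U -> U') (g : V -> V')
  (t : U ⊗ V) : U' ⊗ V' := \tsum_(u ⊗ v <- t) f u ⊗ g v.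

Definition tassoc (U V W : lmodType k) (t : (U ⊗ V) ⊗ W) : U ⊗ (V ⊗ W) :=
  \tsum_(uv ⊗ w <- t) \tsum_(u ⊗ v <- uv) u ⊗ (v ⊗ w).

Definition tmul (A B : algType k) (s t : A ⊗ B) : A ⊗ B :=
  \tsum_(a ⊗ b <- s) \tsum_(a' ⊗ b' <- t) (a * a') ⊗ (b * b').

Lemma tmapE (U V U' V' : lmodType k) (f : {linear U -> U'})
  (g : {linear V -> V'}) u v : tmap f g (u ⊗ v) = f u ⊗ g v.
Proof.
have [tl tr] := @tens_bilinear k U' V'.
rewrite /tmap tliftE //; split=> [w a x y|w a x y].
  by rewrite linearP; apply: tl.
by rewrite linearP; apply: tr.
Qed.

Lemma tassocE (U V W : lmodType k) (u : U) (v : V) (w : W) :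
  tassoc ((u ⊗ v) ⊗ w) = u ⊗ (v ⊗ w).
Proof.
have [l1 r1] := @tens_bilinear k V W.
have [l2 r2] := @tens_bilinear k U (V ⊗ W)%type.
have aux (M : lmodType k) (a b : k) (p q r s : M) :
    b *: (a *: p + q) + (a *: r + s) = a *: (b *: p + r) + (b *: q + s).
  by rewrite !scalerDr !scalerA addrACA (mulrC a).
have bil z : bilinear_map (fun u v => u ⊗ (v ⊗ z) : (U ⊗ (V ⊗ W))%type).
  split=> [y a x x'|y a x x']; first exact: l2.
  by rewrite (l1 z a x x') /=; apply: r2.
rewrite /tassoc tliftE ?tliftE //; split=> [z|t a x x'].
  by apply: tlift_linear.
elim/(@tensor_ind k U V): t => [|b y z t IH].
  by rewrite !(tlift0 (bil _)) scaler0 addr0.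
rewrite !(tlift_linear (bil _)) !tliftE // (r1 z a x x') r2 IH.
exact: aux.
Qed.

Lemma tmulE (A B : algType k) (a a' : A) (b b' : B) :
  tmul (a ⊗ b) (a' ⊗ b') = (a * a') ⊗ (b * b').
Proof.
have [tl tr] := @tens_bilinear k A B.
have bil c d : bilinear_map (fun a' b' => (c * a') ⊗ (d * b') : (A ⊗ B)%type).
  split=> [y e x x'|y e x x']; rewrite mulrDr -scalerAr; [exact: tl|exact: tr].
rewrite /tmul.
rewrite (@tliftE _ _ _ _ (fun a b => \tsum_(a' ⊗ b' <- a' ⊗ b') _)) ?tliftE //.
by split=> [y e x x'|y e x x'] /=; rewrite !tliftE // mulrDl -scalerAl;
  [apply: tl | apply: tr].
Qed.

End TensorMaps.

HB.mixin Record isCoalgebra (k : fieldType) C of GRing.Lmodule k C := {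
  comul : {linear C -> (C ⊗ C)%type};
  counit : {scalar C};
  comulA : forall c : C,
    tassoc (tmap comul idfun (comul c)) = tmap idfun comul (comul c);
  counitl : forall c : C, \tsum_(a ⊗ b <- comul c) counit a *: b = c;
  counitr : forall c : C, \tsum_(a ⊗ b <- comul c) counit b *: a = c
}.

#[short(type="coalgType")]
HB.structure Definition Coalgebra (k : fieldType) :=
  {C of GRing.Lmodule k C & isCoalgebra k C}.

HB.mixin Record isBialgebra (k : fieldType) B
    of GRing.Algebra k B & Coalgebra k B := {
  comul1 : comul (1 : B) = 1 ⊗ 1;
  comulM : forall x y : B, comul (x * y) = tmul (comul x) (comul y);
  counit1 : counit (1 : B) = 1;
  counitM : forall x y : B, counit (x * y) = counit x * counit y
}.

#[short(type="bialgType")]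
HB.structure Definition Bialgebra (k : fieldType) :=
  {B of GRing.Algebra k B & Coalgebra k B & isBialgebra k B}.

HB.mixin Record isHopf (k : fieldType) H of Bialgebra k H := {
  antipode : {linear H -> H};
  antipodel : forall h : H,
    \tsum_(a ⊗ b <- comul h) antipode a * b = (counit h)%:A;
  antipoder : forall h : H,
    \tsum_(a ⊗ b <- comul h) a * antipode b = (counit h)%:A
}.

#[short(type="hopfAlgType")]
HB.structure Definition Hopf (k : fieldType) :=
  {H of Bialgebra k H & isHopf k H}.

Section Modules.
Context {k : fieldType}.

Record right_module (A : algType k) (M : lmodType k) := RightModule {
  ract : M -> A -> M;
  ract_bilinear : bilinear_map ract;
  ract1 : forall m, ract m 1 = m;
  ractM : forall m a b, ract m (a * b) = ract (ract m a) b
}.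

Record left_comodule (C : coalgType k) (M : lmodType k) := LeftComodule {
  coact : M -> (C ⊗ M)%type;
  coact_linear : linear coact;
  coactA : forall m,
    tassoc (tmap comul idfun (coact m)) = tmap idfun coact (coact m);
  coact_counit : forall m, \tsum_(c ⊗ n <- coact m) counit c *: n = m
}.

Definition group_like (C : coalgType k) (s : C) : Prop :=
  comul s = s ⊗ s /\ counit s = 1.

Section CharacterModule.
Context (A : algType k) (delta : {lrmorphism A -> k | *%R}).

Definition char_ract (l : k^o) (a : A) : k^o := l * delta a.

Lemma char_ract_bilinear : bilinear_map char_ract.
Proof.
split=> [a c l l'|l c a b]; rewrite /char_ract.
  by rewrite /= mulrDl -scalerAl.
by rewrite linearP mulrDr scalerAr.
Qed.

Lemma char_ract1 l : char_ract l 1 = l.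
Proof. by rewrite /char_ract rmorph1 mulr1. Qed.

Lemma char_ractM l a b : char_ract l (a * b) = char_ract (char_ract l a) b.
Proof. by rewrite /char_ract rmorphM mulrA. Qed.

Definition char_module : right_module A k^o :=
  RightModule char_ract_bilinear char_ract1 char_ractM.

End CharacterModule.

Section GroupLikeComodule.
Context (C : coalgType k) (sigma : C) (sigmaP : group_like sigma).

Definition group_like_coact (l : k^o) : (C ⊗ k^o)%type := sigma ⊗ l.

Lemma group_like_coact_linear : linear group_like_coact.
Proof. by case: (@tens_bilinear k C k^o) => _; apply. Qed.

HB.instance Definition _ := GRing.isLinear.Build k k^o (C ⊗ k^o)%type _
  group_like_coact group_like_coact_linear.

Lemma group_like_coactA l :
  tassoc (tmap comul idfun (group_like_coact l)) =
  tmap idfun group_like_coact (group_like_coact l).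
Proof.
case: sigmaP => sigma2 _; rewrite [in LHS]/group_like_coact tmapE sigma2.
by rewrite tassocE tmapE.
Qed.

Lemma group_like_coact_counit l :
  \tsum_(c ⊗ n <- group_like_coact l) counit c *: n = l.
Proof.
case: sigmaP => _ sigma1; rewrite tliftE ?sigma1 ?scale1r //.
split=> [n a c c'|c a n n'] /=; first by rewrite linearP scalerDl scalerA.
by rewrite scalerDr !scalerA mulrC.
Qed.

Definition group_like_comodule : left_comodule C k^o :=
  LeftComodule group_like_coact_linear
    group_like_coactA group_like_coact_counit.

End GroupLikeComodule.
End Modules.

Section StableAntiYetterDrinfeld.
Context {k : fieldType} {H : hopfAlgType k}.

(* h^(1) ⊗ (h^(2) ⊗ h^(3))                                                    *)
Definition comul2 (h : H) : (H ⊗ (H ⊗ H))%type :=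
  tmap idfun comul (comul h).

Definition anti_Yetter_Drinfeld (M : lmodType k)
    (rM : right_module H M) (lM : left_comodule H M) : Prop :=
  forall (m : M) (h : H),
    coact lM (ract rM m h) =
    \tsum_(h1 ⊗ h23 <- comul2 h) \tsum_(h2 ⊗ h3 <- h23)
      \tsum_(m' ⊗ m0 <- coact lM m)
        (antipode h3 * m' * h1) ⊗ ract rM m0 h2.

Definition stable (M : lmodType k)
    (rM : right_module H M) (lM : left_comodule H M) : Prop :=
  forall m : M, \tsum_(m' ⊗ m0 <- coact lM m) ract rM m0 m' = m.

Definition twisted_antipode (delta : {lrmorphism H -> k | *%R}) (h : H) : H :=
  \tsum_(h1 ⊗ h2 <- comul h) delta h1 *: antipode h2.

(* sigma' is the inverse of sigma; it is unique, and it exists (it is         *)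
(* antipode sigma) whenever sigma is group-like.                              *)
Definition modular_pair_in_involution
    (delta : {lrmorphism H -> k | *%R}) (sigma : H) : Prop :=
  delta sigma = 1 /\
  exists sigma' : H, [/\ sigma * sigma' = 1, sigma' * sigma = 1 &
    forall h : H, twisted_antipode delta (twisted_antipode delta h) =
                  sigma * h * sigma'].

End StableAntiYetterDrinfeld.

(* Main.v *)
(* Stability of k says delta sigma = 1.  Write T for the twisted antipode.    *)
(* The anti-Yetter-Drinfeld condition on k reads T(h^(2)) sigma h^(1) =       *)
(* delta(h) sigma, that is, X(h) = sigma h sigma^-1 solves T(h^(2)) X(h^(1))  *)
(* = delta(h). Since T(h^(1)) h^(2) = delta(h) and T is anti-multiplicative,  *)
(* applying T shows that X = T^2 solves the same equation, and the solution   *)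
(* is unique because T is invertible for the co-opposite convolution: it is   *)
(* the product of S and delta, whose inverses are S^2 and delta o S.          *)
Require Import Defs.
From HB Require Import structures.
From mathcomp Require Import all_boot all_algebra.

Import GRing.Theory.
Local Open Scope ring_scope.

(** Write [T] for the twisted antipode. On [k], stability amounts to [delta sigma = 1]
    ([stable_char]). The scalar [delta h^(2)] crosses the tensor sign, so the anti-Yetter-Drinfeld
    condition becomes [T(h^(2)) sigma h^(1) = delta(h) sigma] ([anti_Yetter_Drinfeld_char]):
    conjugation by [sigma] solves [T(h^(2)) X(h^(1)) = delta(h) 1]. The square of [T] always solves
    this equation, by applying the product-reversing map [T] to [T(h^(1)) h^(2) = delta(h) 1]
    ([twisted_antipode_sqr]). Solutions are unique, because [T] has a left inverse for co-opposite
    convolution ([twisted_antipode_eq0]). Hence the condition says exactly that the two solutions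
    agree. *)

(** * Calculus of sums over tensors *)

Section TensorLift.
Set Implicit Arguments.
Unset Strict Implicit.

Context {k : fieldType}.
Implicit Types U V W X : lmodType k.

(** [tlift] is a finite sum over a chosen representative, so it respects pointwise equality of
    arbitrary functions; [under] uses this to rewrite inside Sweedler sums. *)
Lemma eq_tlift U V W (f g : U -> V -> W) (t : (U ⊗ V)%type) :
  f =2 g -> tlift f t = tlift g t.
Proof.
by move=> fg; rewrite tlift.unlock; apply: eq_bigr => p _; rewrite fg.
Qed.

Lemma linear_tlift U V W W' (g : W -> W') (f : U -> V -> W) (t : (U ⊗ V)%type) :
  linear g -> bilinear_map f ->
  g (tlift f t) = tlift (fun u v => g (f u v)) t.
Proof.
move=> gl fb; have gfb : bilinear_map (fun u v => g (f u v)).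
  case: fb => fl fr; split=> [v a u u'|u a v v'] /=.
    by rewrite (fl v a u u') gl.
  by rewrite (fr u a v v') gl.
have g0 : g 0 = 0.
  by move: (GRing.scalable_linear gl 0 0); rewrite /= !scale0r.
elim/(@tensor_ind k U V): t => [|a u v t IH]; first by rewrite !tlift0.
by rewrite !tlift_linear // gl !tliftE // IH.
Qed.

(** Supplies the bilinearity side conditions of nested sums, where the inner sum depends on a
    parameter. *)
Lemma tlift_param_linear (P U V W : lmodType k)
  (F : P -> U -> V -> W) (t : (U ⊗ V)%type) :
  (forall p, bilinear_map (F p)) -> (forall u v, linear (fun p => F p u v)) ->
  linear (fun p => tlift (F p) t : W).
Proof.
move=> Fb Fl a p q; elim/(@tensor_ind k U V): t => [|b u v t IH].
  by rewrite !tlift0 // scaler0 addr0.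
rewrite !tlift_linear // !tliftE // Fl IH !scalerDr !scalerA addrACA.
by rewrite (mulrC a).
Qed.

Lemma tlift_tmap U V U' V' W (g : {linear U -> U'}) (g' : {linear V -> V'})
  (f : U' -> V' -> W) (t : (U ⊗ V)%type) : bilinear_map f ->
  tlift f (tmap g g' t) = tlift (fun u v => f (g u) (g' v)) t.
Proof.
move=> fb; have [tl tr] := @tens_bilinear k U' V'.
rewrite /tmap (linear_tlift (g := tlift f)); last first.
- split=> [v a u u'|u a v v']; first by rewrite linearP; apply: tl.
  by rewrite linearP; apply: tr.
- exact: tlift_linear.
by apply: eq_tlift => u v; rewrite tliftE.
Qed.

Definition trilinear_map U V W X (F : U -> V -> W -> X) :=
  [/\ forall v w, linear (fun u => F u v w),
      forall u w, linear (fun v => F u v w) & forall u v, linear (F u v)].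

Lemma tlift_tassoc U V W X (F : U -> V -> W -> X) (t : ((U ⊗ V) ⊗ W)%type) :
  trilinear_map F ->
  tlift (fun u vw => tlift (F u) vw) (tassoc t) =
  tlift (fun uv w => tlift (fun u v => F u v w) uv) t.
Proof.
case=> F1 F2 F3.
have b1 u : bilinear_map (F u) by split=> [w|v]; [apply: F2|apply: F3].
have b2 w : bilinear_map (fun u v => F u v w).
  by split=> [v|u]; [apply: F1|apply: F2].
have B1 : bilinear_map (fun u vw => tlift (F u) vw).
  split=> [vw|u]; last exact: tlift_linear.
  exact: (@tlift_param_linear _ _ _ _ F).
have B2 : bilinear_map (fun uv w => tlift (fun u v => F u v w) uv).
  split=> [w|uv]; first exact: tlift_linear.
  by apply: (@tlift_param_linear _ _ _ _ (fun w u v => F u v w)).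
have [l1 r1] := @tens_bilinear k V W.
have [l2 r2] := @tens_bilinear k U (V ⊗ W)%type.
have bA w : bilinear_map (fun u v => u ⊗ (v ⊗ w) : (U ⊗ (V ⊗ W))%type).
  split=> [v a u u'|u a v v']; first exact: l2.
  by rewrite (l1 w a v v') /=; apply: r2.
rewrite /tassoc (linear_tlift (g := tlift _)); last 2 first.
- exact: tlift_linear.
- split=> [w|uv]; first exact: tlift_linear.
  apply: (@tlift_param_linear _ _ _ _ (fun w u v => u ⊗ (v ⊗ w))) => //.
  move=> u v a w w'.
  by rewrite (r1 v a w w'); apply: r2.
apply: eq_tlift => uv w; rewrite (linear_tlift (g := tlift _)) //; last first.
  exact: tlift_linear.
by apply: eq_tlift => u v; rewrite !tliftE.
Qed.

Lemma tlift_cst0 U V W (t : (U ⊗ V)%type) : tlift (fun _ _ => 0 : W) t = 0.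
Proof.
by rewrite tlift.unlock /free_lift big1 // => p _; rewrite scaler0.
Qed.

Lemma tliftB U V W (f g : U -> V -> W) (t : (U ⊗ V)%type) :
  tlift (fun u v => f u v - g u v) t = tlift f t - tlift g t.
Proof.
by rewrite tlift.unlock -sumrB; apply: eq_bigr => p _; rewrite scalerBr.
Qed.

Lemma tlift_tens U V (t : (U ⊗ V)%type) : tlift tens t = t.
Proof.
have tb := @tens_bilinear k U V.
elim/(@tensor_ind k U V): t => [|a u v t IH]; first by rewrite tlift0.
by rewrite tlift_linear // tliftE // IH.
Qed.

(** The right side is linear in [s], so it is determined by its values on pure tensors, where the
    inner sum collapses. *)
Lemma exchange_tlift U V U' V' W (F : U -> V -> U' -> V' -> W)
  (s : (U ⊗ V)%type) (t : (U' ⊗ V')%type) :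
  (forall u v, bilinear_map (F u v)) ->
  (forall u' v', bilinear_map (fun u v => F u v u' v')) ->
  \tsum_(u ⊗ v <- s) \tsum_(u' ⊗ v' <- t) F u v u' v' =
  \tsum_(u' ⊗ v' <- t) \tsum_(u ⊗ v <- s) F u v u' v'.
Proof.
move=> F1 F2; pose G s := \tsum_(u' ⊗ v' <- t) \tsum_(u ⊗ v <- s) F u v u' v'.
have Gl : linear G.
  apply: (@tlift_param_linear _ _ _ _
            (fun s u' v' => \tsum_(u ⊗ v <- s) F u v u' v')).
  - move=> p; split=> [v'|u'].
      apply: (@tlift_param_linear _ _ _ _ (fun u' u v => F u v u' v')) => //.
      by move=> u v; case: (F1 u v) => + _; apply.
    apply: (@tlift_param_linear _ _ _ _ (fun v' u v => F u v u' v')) => //.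
    by move=> u v; case: (F1 u v) => _; apply.
  - by move=> u' v'; apply: tlift_linear.
rewrite -[RHS]/(G s) -[in RHS](tlift_tens s) linear_tlift //; last first.
  exact: tens_bilinear.
by apply: eq_tlift => u v; apply: eq_tlift => u' v'; rewrite tliftE.
Qed.

Lemma tlift_tmul (A B : algType k) W (f : A -> B -> W) (s t : (A ⊗ B)%type) :
  bilinear_map f ->
  tlift f (tmul s t) =
  \tsum_(a' ⊗ b' <- t) \tsum_(a ⊗ b <- s) f (a * a') (b * b').
Proof.
move=> fb; have [fl fr] := fb; have [tl tr] := @tens_bilinear k A B.
have b1 a b : bilinear_map (fun a' b' => f (a * a') (b * b')).
  split=> [v c x y|u c x y] /=; rewrite mulrDr -scalerAr.
    by rewrite (fl _ c).
  by rewrite (fr _ c).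
have b2 a' b' : bilinear_map (fun a b => f (a * a') (b * b')).
  split=> [v c x y|u c x y] /=; rewrite mulrDl -scalerAl.
    by rewrite (fl _ c).
  by rewrite (fr _ c).
have t1 a b : bilinear_map (fun a' b' => (a * a') ⊗ (b * b') : (A ⊗ B)%type).
  split=> [v c x y|u c x y] /=; rewrite mulrDr -scalerAr.
    by rewrite (tl _ c).
  by rewrite (tr _ c).
have t2 a' b' : bilinear_map (fun a b => (a * a') ⊗ (b * b') : (A ⊗ B)%type).
  split=> [v c x y|u c x y] /=; rewrite mulrDl -scalerAl.
    by rewrite (tl _ c).
  by rewrite (tr _ c).
rewrite -exchange_tlift // /tmul (linear_tlift (g := tlift f)); last 2 first.
- exact: tlift_linear.
- split=> [b|a].
    apply: (@tlift_param_linear _ _ _ _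
              (fun a a' b' => (a * a') ⊗ (b * b') : (A ⊗ B)%type)) => // a' b'.
    by case: (t2 a' b') => + _; apply.
  apply: (@tlift_param_linear _ _ _ _
            (fun b a' b' => (a * a') ⊗ (b * b') : (A ⊗ B)%type)) => // a' b'.
  by case: (t2 a' b') => _; apply.
apply: eq_tlift => a b; rewrite (linear_tlift (g := tlift f)) //; last first.
  exact: tlift_linear.
by apply: eq_tlift => a' b'; rewrite tliftE.
Qed.

End TensorLift.

(** * Coassociativity and counit laws in Sweedler form *)

Section Sweedler.
Set Implicit Arguments.
Unset Strict Implicit.

Context {k : fieldType} {C : coalgType k}.
Implicit Types W : lmodType k.

Lemma tlift_comul_linear W (f : C -> C -> W) :
  bilinear_map f -> linear (fun h => tlift f (comul h)).
Proof. by move=> fb a x y; rewrite linearP tlift_linear. Qed.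

Lemma tlift_comulA W (F : C -> C -> C -> W) (h : C) : trilinear_map F ->
  \tsum_(a ⊗ c <- comul h) \tsum_(a1 ⊗ a2 <- comul a) F a1 a2 c =
  \tsum_(a ⊗ c <- comul h) \tsum_(c1 ⊗ c2 <- comul c) F a c1 c2.
Proof.
move=> Ft; have [F1 F2 F3] := Ft.
have b1 u : bilinear_map (F u) by split=> [w|v]; [apply: F2|apply: F3].
have b2 w : bilinear_map (fun u v => F u v w).
  by split=> [v|u]; [apply: F1|apply: F2].
have := tlift_tassoc (tmap comul idfun (comul h)) Ft.
rewrite comulA !tlift_tmap //.
- split=> [w|uv]; first exact: tlift_linear.
  by apply: (@tlift_param_linear _ _ _ _ _ (fun w u v => F u v w)).
- split=> [vw|u]; last exact: tlift_linear.
  exact: (@tlift_param_linear _ _ _ _ _ F).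
Qed.

Lemma tlift_counitl W (f : C -> W) h : linear f ->
  \tsum_(a ⊗ b <- comul h) counit a *: f b = f h.
Proof.
move=> fl; rewrite -[in RHS](counitl h) linear_tlift //.
  by apply: eq_tlift => a b; rewrite (GRing.scalable_linear fl).
split=> [v a u u'|u a v v'] /=; first by rewrite linearP scalerDl scalerA.
by rewrite scalerDr !scalerA mulrC.
Qed.

Lemma tlift_counitr W (f : C -> W) h : linear f ->
  \tsum_(a ⊗ b <- comul h) counit b *: f a = f h.
Proof.
move=> fl; rewrite -[in RHS](counitr h) linear_tlift //.
  by apply: eq_tlift => a b; rewrite (GRing.scalable_linear fl).
split=> [v a u u'|u a v v'] /=; last by rewrite linearP scalerDl scalerA.
by rewrite scalerDr !scalerA mulrC.
Qed.

End Sweedler.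

(** Proves (multi)linearity of products and scalings of linear maps: distribute, pull scalars to the
    front, and commute two scalars if needed. *)
Ltac multilinear := repeat split; do ?[move=> ?]; rewrite /=;
  do 4?[rewrite ?linearP ?mulrDl ?mulrDr ?scalerDl ?scalerDr;
        rewrite -?scalerAl -?scalerAr ?scalerA /=];
  first [done | by rewrite mulrC].

(** * Convolution and anti-multiplicativity *)

Section HopfAlgebra.
Set Implicit Arguments.
Unset Strict Implicit.
Context {k : fieldType} {H : hopfAlgType k}.
Local Notation S := (@antipode k H).

(** Convolve [f * id = g] on the right with [S], the convolution inverse of the identity. *)
Lemma convolution_antipode (f : {linear H -> H}) (g : H -> H) :
  (forall h, \tsum_(a ⊗ b <- comul h) f a * b = g h) ->
  forall h, f h = \tsum_(a ⊗ b <- comul h) g a * S b.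
Proof.
move=> fg h; under eq_tlift => a b.
  rewrite -fg (linear_tlift (g := fun x => x * S b)); [over|multilinear|].
  multilinear.
rewrite (tlift_comulA (F := fun x y z => f x * y * S z)); last by multilinear.
under eq_tlift => a b.
  under eq_tlift => c d do rewrite -mulrA.
  rewrite -(linear_tlift (g := fun x => f a * x)); [|multilinear..].
  rewrite antipoder -scalerAr mulr1; over.
by rewrite tlift_counitr //; multilinear.
Qed.

(** For the co-opposite convolution [(u, f) |-> u(h^(2)) f(h^(1))], the map [v] is a left inverse of
    [u]; by associativity [f] equals [v] convolved with zero. *)
Lemma cop_convolution_eq0 (u v f : {linear H -> H}) :
  (forall h, \tsum_(a ⊗ b <- comul h) v b * u a = (counit h)%:A) ->
  (forall h, \tsum_(a ⊗ b <- comul h) u b * f a = 0) ->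
  forall h, f h = 0.
Proof.
move=> vu uf h; rewrite -[LHS](tlift_counitr h); last by multilinear.
under eq_tlift => a b.
  rewrite -[_ *: _]mul1r -scalerAr scalerAl -vu.
  rewrite (linear_tlift (g := fun x => x * f a)); [|multilinear..].
  under eq_tlift => c d do rewrite -mulrA.
  over.
rewrite -(tlift_comulA (F := fun x y z => v z * (u y * f x))); last by multilinear.
under eq_tlift => a b.
  rewrite -(linear_tlift (g := fun x => v b * x)); [|multilinear..].
  rewrite uf mulr0; over.
exact: tlift_cst0.
Qed.

(** Bundles an anonymous function with its linearity proof, so that the convolution lemmas apply to
    it. *)
Definition as_linear (V W : lmodType k) (f : V -> W) (fl : linear f) :
  {linear V -> W} := HB.pack f (GRing.isLinear.Build k V W *:%R f fl).

Section AntiMultiplicative.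
Context (T : {linear H -> H}) (chi : {scalar H}).
Context (chiM : forall x y, chi (x * y) = chi x * chi y).
Context (convT : forall h, \tsum_(a ⊗ b <- comul h) T a * b = (chi h)%:A).

(** A general multiplicative [chi] covers both the antipode ([chi = counit]) and the twisted
    antipode ([chi = delta]). The hypothesis forces [T] to be the convolution product of [chi] and
    [S]. *)
Lemma convolution_inverseM x y : T (x * y) = T y * T x.
Proof.
have convT_S h : T h = \tsum_(a ⊗ b <- comul h) chi a *: S b.
  rewrite (convolution_antipode convT); apply: eq_tlift => a b.
  by rewrite -scalerAl mul1r.
(* Convolution with S cancels h^(2) one factor of the product at a time:     *)
(* first in v, then in x below.                                              *)
have Tchi u v : \tsum_(a ⊗ b <- comul u) T (a * v) * b = chi u *: T v.
  have fl : linear (fun z => \tsum_(a ⊗ b <- comul u) T (a * z) * b).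
    by apply: (@tlift_param_linear _ _ _ _ _ (fun z a b => T (a * z) * b));
      multilinear.
  rewrite -[LHS]/(as_linear fl v).
  rewrite (convolution_antipode (f := as_linear fl)
             (g := fun z => (chi u * chi z)%:A)).
    rewrite convT_S (linear_tlift (g := fun z => chi u *: z)).
    - by apply: eq_tlift => a b; rewrite -scalerAl mul1r scalerA.
    - multilinear.
    - multilinear.
  move=> h; rewrite -chiM -convT comulM tlift_tmul; last by multilinear.
  apply: eq_tlift => a b; rewrite (linear_tlift (g := fun z => z * b)).
  - by apply: eq_tlift => c d; rewrite mulrA.
  - multilinear.
  - multilinear.
have fl : linear (fun z => T (z * y)) by multilinear.
rewrite -[LHS]/(as_linear fl x).
rewrite (convolution_antipode (f := as_linear fl) (g := fun z => chi z *: T y));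
  last by move=> u; exact: Tchi.
rewrite [in RHS](convT_S x) (linear_tlift (g := fun z => T y * z)).
- by apply: eq_tlift => a b; rewrite -scalerAl -scalerAr.
- multilinear.
- multilinear.
Qed.

Context (chi1 : chi 1 = 1).

Lemma convolution_inverse1 : T 1 = 1.
Proof.
have := convT 1; rewrite comul1 tliftE; last by multilinear.
by rewrite mulr1 chi1 scale1r.
Qed.

End AntiMultiplicative.

Lemma antipodeM x y : S (x * y) = S y * S x.
Proof.
exact: (convolution_inverseM (chi := counit))
  (@counitM k H) (@antipodel k H) _ _.
Qed.

Lemma antipode1 : S 1 = 1.
Proof.
exact: (convolution_inverse1 (chi := counit)) (@antipodel k H) (@counit1 k H).
Qed.

(** * The twisted antipode *)

Section TwistedAntipode.
Context (delta : {lrmorphism H -> k | *%R}).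
Local Notation T := (twisted_antipode delta).

Lemma twisted_antipode_linear : linear T.
Proof.
by apply: (tlift_comul_linear (f := fun a b => delta a *: S b)); multilinear.
Qed.

HB.instance Definition _ :=
  GRing.isLinear.Build k H H *:%R T twisted_antipode_linear.

(** [T] is the convolution product of [delta] and [S], and [S] cancels against the identity. *)
Lemma twisted_antipodel h : \tsum_(a ⊗ b <- comul h) T a * b = (delta h)%:A.
Proof.
under eq_tlift => a b.
  rewrite /twisted_antipode (linear_tlift (g := fun x => x * b));
    [|multilinear..].
  over.
rewrite (tlift_comulA (F := fun x y z => (delta x *: S y) * z));
  last by multilinear.
under eq_tlift => a b.
  under eq_tlift => c d do rewrite -scalerAl.
  rewrite -(linear_tlift (g := fun x => delta a *: x)); [|multilinear..].
  rewrite antipodel scalerA mulrC -scalerA; over.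
by rewrite (tlift_counitr (f := fun h => (delta h)%:A)) //; multilinear.
Qed.

Lemma twisted_antipodeM x y : T (x * y) = T y * T x.
Proof.
exact: (convolution_inverseM (chi := delta) (T := T))
  (rmorphM delta) twisted_antipodel _ _.
Qed.

Lemma twisted_antipode1 : T 1 = 1.
Proof.
exact: (convolution_inverse1 (chi := delta) (T := T))
  twisted_antipodel (rmorph1 delta).
Qed.

Lemma twisted_antipode_sqr h :
  \tsum_(a ⊗ b <- comul h) T b * T (T a) = (delta h)%:A.
Proof.
rewrite -[in RHS]twisted_antipode1 -linearZ -twisted_antipodel /=.
rewrite (linear_tlift (g := T)); last by multilinear.
  by apply: eq_tlift => a b; rewrite twisted_antipodeM.
exact: twisted_antipode_linear.
Qed.

(** [T] is the co-opposite product of [S] and [delta], so its two factors can be cancelled in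
    turn. *)
Lemma twisted_antipode_eq0 (f : {linear H -> H}) :
  (forall h, \tsum_(a ⊗ b <- comul h) T b * f a = 0) ->
  forall h, f h = 0.
Proof.
(* [g] is [delta] convolved with [f], so the hypothesis says that [S] convolved with [g]
   vanishes. *)
move=> Tf; pose g h := \tsum_(a ⊗ b <- comul h) delta b *: f a.
have gl : linear g.
  by apply: (tlift_comul_linear (f := fun a b => delta b *: f a)); multilinear.
have dl : linear (fun h => (delta h)%:A : H) by multilinear.
have dSl : linear (fun h => (delta (S h))%:A : H) by multilinear.
have SSl : linear (fun h => S (S h)) by multilinear.
have g0 h : g h = 0.
  rewrite -[LHS]/(as_linear gl h).
  (* The left inverse of [S] is its square: [S(S b) S(a) = S(a S(b))]. *)
  apply: (cop_convolution_eq0 (u := S) (v := as_linear SSl)) => {}h /=.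
    under eq_tlift => a b do rewrite -antipodeM.
    rewrite -(linear_tlift (g := S)); [|multilinear..].
    by rewrite antipoder linearZ /= antipode1.
  rewrite -[RHS](Tf h) /g /twisted_antipode.
  under eq_tlift => a b.
    rewrite (linear_tlift (g := fun x => S b * x)); [|multilinear..].
    over.
  rewrite (tlift_comulA (F := fun x y z => S z * (delta y *: f x)));
    last by multilinear.
  apply: eq_tlift => a b.
  rewrite (linear_tlift (g := fun x => x * f a)); [|multilinear..].
  by apply: eq_tlift => c d; rewrite -scalerAl -scalerAr.
(* Likewise [delta] composed with [S] inverts [delta], since
   [delta(a) delta(S b) = delta(a S(b))]. *)
apply: (cop_convolution_eq0 (u := as_linear dl) (v := as_linear dSl)) => h /=.
  under eq_tlift => a b do rewrite -scalerAl mul1r scalerA mulrC -rmorphM.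
  rewrite -(linear_tlift (g := fun x => (delta x)%:A : H)); [|multilinear..].
  by rewrite antipoder linearZ /= rmorph1 mulr1.
by rewrite -[RHS](g0 h); apply: eq_tlift => a b; rewrite -scalerAl mul1r.
Qed.

(** * The two module conditions on the ground field *)

Section GroupLike.
Context (sigma : H) (sigmaP : group_like sigma).

Lemma group_like_mulVg : S sigma * sigma = 1.
Proof.
case: sigmaP => sigma2 sigma1; have := antipodel sigma.
by rewrite sigma2 tliftE ?sigma1 ?scale1r //; multilinear.
Qed.

Lemma group_like_mulgV : sigma * S sigma = 1.
Proof.
case: sigmaP => sigma2 sigma1; have := antipoder sigma.
by rewrite sigma2 tliftE ?sigma1 ?scale1r //; multilinear.
Qed.

Lemma stable_char :
  stable (char_module delta) (group_like_comodule sigmaP) <-> delta sigma = 1.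
Proof.
have stE (l : k^o) : \tsum_(c ⊗ m <- coact (group_like_comodule sigmaP) l)
     ract (char_module delta) m c = l * delta sigma.
  by rewrite /= /group_like_coact tliftE // /char_ract; multilinear.
split=> [/(_ 1)|d1 l]; first by rewrite stE mul1r.
by rewrite stE d1 mulr1.
Qed.

(** In [S(h^(3)) sigma h^(1) ⊗ l delta(h^(2))] the scalar moves to the left factor, where
    [delta(h^(2)) S(h^(3))] assembles into [T]. *)
Lemma anti_Yetter_Drinfeld_char :
  anti_Yetter_Drinfeld (char_module delta) (group_like_comodule sigmaP) <->
  forall h, \tsum_(a ⊗ b <- comul h) T b * sigma * a = delta h *: sigma.
Proof.
have [tl tr] := @tens_bilinear k H k^o.
have tlZ c (x : H) (l : k^o) : (c *: x) ⊗ l = c *: (x ⊗ l).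
  exact: (GRing.scalable_linear (tl l)).
have trZ c (x : H) (l : k^o) : x ⊗ (c *: l) = c *: (x ⊗ l).
  exact: (GRing.scalable_linear (tr x)).
have Fb (l : k^o) (h1 : H) : bilinear_map (fun h2 h3 : H =>
    (S h3 * sigma * h1) ⊗ (l * delta h2 : k^o) : (H ⊗ k^o)%type).
  split=> [h3|h2] a x y /=.
    by rewrite linearP mulrDr -scalerAr; apply: tr.
  by rewrite linearP !mulrDl -!scalerAl; apply: tl.
have coactE (l : k^o) h :
    \tsum_(h1 ⊗ h23 <- comul2 h) \tsum_(h2 ⊗ h3 <- h23)
      \tsum_(c ⊗ m <- coact (group_like_comodule sigmaP) l)
        (S h3 * c * h1) ⊗ ract (char_module delta) m h2 =
    (\tsum_(a ⊗ b <- comul h) T b * sigma * a) ⊗ l.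
  under eq_tlift => h1 h23.
    under eq_tlift => h2 h3.
      rewrite /= /group_like_coact tliftE /char_ract; last first.
        split=> [m|c] a x y /=.
          by rewrite mulrDr mulrDl -scalerAr -scalerAl; apply: tl.
        by rewrite mulrDl -scalerAl; apply: tr.
      over.
    over.
  rewrite /comul2 tlift_tmap; last first.
    split=> [h23|h1] a x y; last by rewrite tlift_linear.
    apply: (@tlift_param_linear _ _ _ _ _ (fun h1 h2 h3 : H =>
      (S h3 * sigma * h1) ⊗ (l * delta h2 : k^o) : (H ⊗ k^o)%type)) => //.
    by move=> h2 h3 c u v /=; rewrite mulrDr -scalerAr; apply: tl.
  rewrite (linear_tlift (g := fun x => x ⊗ l)); [|exact: tl|multilinear].
  apply: eq_tlift => a b.
  rewrite /twisted_antipode.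
  rewrite (linear_tlift (g := fun x => (x * sigma * a) ⊗ l)).
  - apply: eq_tlift => b1 b2; rewrite -!scalerAl tlZ -trZ.
    by rewrite [l * _]mulrC.
  - by move=> c x y /=; rewrite !mulrDl -!scalerAl; apply: tl.
  - multilinear.
split=> [ayd h|E l h]; last first.
  rewrite coactE E tlZ /= /group_like_coact /char_ract -trZ.
  by rewrite [l * _]mulrC.
(* This induces the canonical map from [H ⊗ k] to [H], which strips the factor [1] from the
   condition taken at [l = 1]. *)
have rb : bilinear_map (fun (x : H) (l : k^o) => (l : k) *: x).
  by split=> [l a x y|x a l l'] /=;
    rewrite ?scalerDr ?scalerDl !scalerA // mulrC.
have := congr1 (tlift (fun (x : H) (l : k^o) => (l : k) *: x)) (ayd 1 h).
rewrite coactE /= /group_like_coact !tliftE // scale1r => <-.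
by rewrite /char_ract mul1r.
Qed.

End GroupLike.
End TwistedAntipode.
End HopfAlgebra.

Theorem lemma1p2 (k : fieldType) (H : hopfAlgType k)
  (antipode_bij : bijective (@antipode k H))
  (delta : {lrmorphism H -> k | *%R}) (sigma : H) (sigmaP : group_like sigma) :
  (anti_Yetter_Drinfeld (char_module delta) (group_like_comodule sigmaP) /\
   stable (char_module delta) (group_like_comodule sigmaP)) <->
  modular_pair_in_involution delta sigma.
Proof.
rewrite anti_Yetter_Drinfeld_char stable_char.
split=> [[ayd d1]|[d1 [sigma' [sV Vs TT]]]]; split=> //.
  exists (antipode sigma); split=> [||h]; first exact: group_like_mulgV.
    exact: group_like_mulVg.
  (* The difference of the two solutions, to be killed by uniqueness. *)
  have fl : linear (fun h => twisted_antipode delta (twisted_antipode delta h) -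
                             sigma * h * antipode sigma).
    by move=> a x y; rewrite !linearP /= mulrDr mulrDl -scalerAr -scalerAl
       opprD addrACA scalerBr.
  apply/eqP; rewrite -subr_eq0 -[X in X == _]/(as_linear fl h); apply/eqP.
  apply: (@twisted_antipode_eq0 _ _ delta) => {}h /=.
  under eq_tlift => a b do rewrite mulrBr !mulrA.
  rewrite tliftB twisted_antipode_sqr.
  rewrite -(linear_tlift (g := fun x => x * antipode sigma)); [|multilinear..].
  by rewrite ayd -scalerAl group_like_mulgV // subrr.
move=> h.
(* Conversely, expand [delta(h) 1] through the square of [T], which is now conjugation; the trailing
   [sigma' * sigma] cancels. *)
transitivity ((delta h)%:A * sigma); last by rewrite -scalerAl mul1r.
rewrite -twisted_antipode_sqr (linear_tlift (g := fun x => x * sigma)).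
- by apply: eq_tlift => a b; rewrite TT -!mulrA Vs mulr1.
- multilinear.
- multilinear.
Qed.
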